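(* Let $m<n$ and $s\in\{1,\dots,n\}$, let $A\in\mathbb{R}^{m\times n}$ be a matrix with $\ell_2$-normalized columns and coherence $\mu=\mu(A)$, let $\sigma>0$, and let $b=Ax+z$ with $z\sim\mathcal{N}(0,\sigma^2I_m)$. Suppose that $x\in\mathbb{R}^n$ is $s$-sparse and that $$\mu<\frac{1}{4s}.$$ Set $\lambda^*=2\sigma\big(\tfrac54+\sqrt{2\log n}\big)$ and let $\hat{x}^{L}$ be a minimizer of $$\min_{y\in\mathbb{R}^n}\ \lambda^*\|y\|_1+\frac12\|Ay-b\|_2^2 .$$ Then with probability at least $1-\frac{1}{2\sqrt{\pi\log n}}$, $\hat{x}^{L}$ satisfies $$\|\hat{x}^{L}-x\|_2^2\le\frac{16\big(2+\sqrt{2\log n}\big)^2}{\big(\mu(1-4s\mu)\big)^2}\sum_{j=1}^n\min\{\sigma^2,|x(j)|^2\}.$$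
   Context: For a matrix $A\in\mathbb{R}^{m\times n}$ with columns $A_1,\dots,A_n$ satisfying $\|A_i\|_2=1$ for all $i$, the coherence is $\mu(A)=\max_{1\le i\ne j\le n}|\langle A_i,A_j\rangle|$. A vector is $s$-sparse if it has at most $s$ nonzero coordinates; $x(j)$ is the $j$-th coordinate of $x$. The matrix $A$ and the vector $x$ are deterministic and the probability is over $z$. *)

(* Defs.v *)
From mathcomp Require Import all_boot all_order all_algebra.
From mathcomp Require Import all_classical all_reals all_analysis.

Set Implicit Arguments.
Unset Strict Implicit.
Unset Printing Implicit Defensive.

Import Order.TTheory GRing.Theory Num.Theory.

Local Open Scope classical_set_scope.
Local Open Scope ring_scope.

Section Vectors.
Context {R : realType}.

Definition dotv n (u v : 'cV[R]_n) : R := \sum_i u i 0 * v i 0.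

(* The norm `|v| that MathComp-Analysis puts on matrices is the sup norm. *)
Definition l2norm n (v : 'cV[R]_n) : R := Num.sqrt (\sum_i v i 0 ^+ 2).

Definition l1norm n (v : 'cV[R]_n) : R := \sum_i `|v i 0|.

Definition sparse n (s : nat) (x : 'cV[R]_n) : Prop :=
  (#|[pred i | x i 0%R != 0%R]| <= s)%N.

Definition normalized_columns m n (A : 'M[R]_(m, n)) : Prop :=
  forall j, l2norm (col j A) = 1.

(* The default value 0 is harmless: all the terms are nonnegative. *)
Definition coherence m n (A : 'M[R]_(m, n)) : R :=
  \big[Num.max/0]_(p : 'I_n * 'I_n | p.1 != p.2)
    `|dotv (col p.1 A) (col p.2 A)|.

Definition lasso_objective m n (A : 'M[R]_(m, n)) (b : 'cV[R]_m) (lambda : R)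
    (y : 'cV[R]_n) : R :=
  lambda * l1norm y + 2^-1 * l2norm (A *m y - b) ^+ 2.

Definition is_lasso_minimizer m n (A : 'M[R]_(m, n)) (b : 'cV[R]_m)
    (lambda : R) (y : 'cV[R]_n) : Prop :=
  forall y', lasso_objective A b lambda y <= lasso_objective A b lambda y'.

End Vectors.

Section Probability.
Context {d : measure_display} {T : measurableType d} {R : realType}.
Variable P : probability T R.

(* z ~ N(0, sigma^2 I_m), i.e. the coordinates of z are independent random
   variables of law N(0, sigma^2): the law of z is the m-fold product of
   N(0, sigma^2), given here by its values on measurable boxes (a family of
   events indexed by a subset of 'I_m is obtained by taking B i = setT
   elsewhere).  The second parameter of normal_prob is the standard
   deviation. *)
Definition isotropic_gaussian m (sigma : R) (z : T -> 'cV[R]_m) : Prop :=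
  (forall i, measurable_fun [set: T] (fun w => z w i 0)) /\
  (forall B : 'I_m -> set R, (forall i, measurable (B i)) ->
     P [set w | forall i, B i (z w i 0)] =
     (\prod_(i < m) normal_prob 0 sigma (B i))%E).

(* A measure has no meaningful value on a nonmeasurable set, and Q need not be
   measurable (it may involve an arbitrary selection of minimizers), hence the
   measurable event on which Q holds.  When Q is measurable this is equivalent
   to p%:E <= P Q. *)
Definition with_probability_ge (p : R) (Q : set T) : Prop :=
  exists E : set T, [/\ measurable E, E `<=` Q & (p%:E <= P E)%E].

End Probability.

(* Main.v *)
Require Import Defs.
From HB Require Import structures.
From mathcomp Require Import all_boot all_order all_algebra.
From mathcomp Require Import all_classical all_reals all_analysis.
From mathcomp Require Import measurable_realfun ring lra.

Import Order.TTheory GRing.Theory Num.Theory.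

(* On the event that every |<A_j, z>| is at most sigma (5/4 + L), which is half
   of lambda, compare the objective at the minimizer and at x, and split the
   coordinates at T = {j | sigma < |x_j|}: the error h = xhat - x satisfies
   |h|_1 <= 4 |h_T|_1 + 4 |x_(~T)|_1.  Stationarity gives
   |(A^T A h)_j| <= 3 sigma (5/4 + L), hence
   |h_j| <= 3 sigma (5/4 + L) + mu |h|_1, and summing over T bounds
   (1 - 4 s mu) |h|_1 by a multiple of sum_j min(sigma, |x_j|).  The factor
   1 / mu > 4 s of the stated bound absorbs the s lost in bounding this sum by
   the square root of the sum of squares.
   The event is controlled by Chernoff's bound for each <A_j, z> ~ N(0, sigma^2)
   and a union bound: the extra 5/4 in the threshold compensates for Chernoff's
   bound missing the factor 1 / t of the sharp Gaussian tail. *)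

Local Open Scope classical_set_scope.
Local Open Scope ring_scope.

(** * Inner products, coherence and deterministic error bounds for lasso minimizers *)

Section Vectors.
Set Implicit Arguments.
Unset Strict Implicit.
Context {R : realType}.
Implicit Types m n s : nat.

Lemma dotvC n (u v : 'cV[R]_n) : dotv u v = dotv v u.
Proof. by apply: eq_bigr => i _; rewrite mulrC. Qed.

Lemma dotvDr n (u v w : 'cV[R]_n) : dotv u (v + w) = dotv u v + dotv u w.
Proof. by rewrite -big_split; apply: eq_bigr => i _; rewrite mxE mulrDr. Qed.

Lemma dotvZr n a (u v : 'cV[R]_n) : dotv u (a *: v) = a * dotv u v.
Proof. by rewrite /dotv mulr_sumr; apply: eq_bigr => i _; rewrite mxE mulrCA. Qed.

Lemma dotv_ge0 n (u : 'cV[R]_n) : 0 <= dotv u u.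
Proof. by apply: sumr_ge0 => i _; rewrite -expr2 sqr_ge0. Qed.

Lemma l2norm_sqr n (u : 'cV[R]_n) : l2norm u ^+ 2 = dotv u u.
Proof.
rewrite sqr_sqrtr; first by apply: eq_bigr => i _; rewrite expr2.
by apply: sumr_ge0 => i _; rewrite sqr_ge0.
Qed.

Lemma l2norm_sqrDZ n a (u v : 'cV[R]_n) :
  l2norm (u + a *: v) ^+ 2 =
  l2norm u ^+ 2 + 2 * a * dotv v u + a ^+ 2 * l2norm v ^+ 2.
Proof.
rewrite !l2norm_sqr dotvDr dotvZr !(dotvC (u + _)) !dotvDr !dotvZr.
rewrite (dotvC u v); ring.
Qed.

Lemma dotv_mulmx m n (A : 'M[R]_(m, n)) (h : 'cV[R]_n) v :
  dotv v (A *m h) = \sum_j h j 0 * dotv (col j A) v.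
Proof.
rewrite /dotv; under eq_bigr do rewrite mxE mulr_sumr.
rewrite exchange_big; apply: eq_bigr => j _ /=; rewrite mulr_sumr.
by apply: eq_bigr => i _; rewrite !mxE; ring.
Qed.

Lemma l1norm_ge0 n (u : 'cV[R]_n) : 0 <= l1norm u.
Proof. exact: sumr_ge0. Qed.

Lemma ler_l1normD n (u v : 'cV[R]_n) : l1norm (u + v) <= l1norm u + l1norm v.
Proof. by rewrite -big_split ler_sum// => i _; rewrite mxE ler_normD. Qed.

Lemma l1norm_delta n (a : R) (j : 'I_n) :
  l1norm (a *: delta_mx j 0 : 'cV[R]_n) = `|a|.
Proof.
rewrite /l1norm (bigD1 j)//= big1 => [|i /negbTE ij]; rewrite !mxE.
  by rewrite !eqxx mulr1 addr0.
by rewrite ij mulr0 normr0.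
Qed.

Lemma l2norm_sqr_le_l1norm n (u : 'cV[R]_n) : l2norm u ^+ 2 <= l1norm u ^+ 2.
Proof.
rewrite l2norm_sqr expr2 [in leRHS]/l1norm mulr_suml.
apply: ler_sum => i _; rewrite -expr2 -real_normK ?num_real// expr2.
rewrite ler_wpM2l// /l1norm (bigD1 i)//= lerDl; exact: sumr_ge0.
Qed.

Lemma coherence_ge0 m n (A : 'M[R]_(m, n)) : 0 <= coherence A.
Proof. exact: bigmax_ge_id. Qed.

Lemma dotv_col_le_coherence m n (A : 'M[R]_(m, n)) i j :
  i != j -> `|dotv (col i A) (col j A)| <= coherence A.
Proof.
move=> ij.
exact: (le_bigmax_cond 0 (j := (i, j))
  (fun p => `|dotv (col p.1 A) (col p.2 A)|)).
Qed.

(* Coherence 0 would make the n columns orthonormal in dimension m. *)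
Lemma coherence_gt0 m n (A : 'M[R]_(m, n)) :
  (m < n)%N -> normalized_columns A -> 0 < coherence A.
Proof.
move=> mn nA; rewrite lt_neqAle coherence_ge0 andbT; apply/eqP => mu0.
have AA : A^T *m A = 1%:M.
  apply/matrixP => i j; transitivity (dotv (col i A) (col j A)).
    by rewrite mxE; apply: eq_bigr => k _; rewrite !mxE.
  rewrite [RHS]mxE; have [<-|/dotv_col_le_coherence] := eqVneq i j.
    by rewrite -l2norm_sqr nA expr1n.
  by move=> /(_ _ A); rewrite -mu0 normr_le0 => /eqP.
have := mxrankM_maxr A^T A.
by rewrite AA mxrank1 leqNgt (leq_ltn_trans (rank_leq_row A)).
Qed.

(** If [|g|] exceeded [lambda] by [t > 0], moving coordinate [j] by [t] against the sign of [g]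
    would change the objective by at most [lambda * t - t * |g| + t ^+ 2 / 2 = - t ^+ 2 / 2 < 0]. *)
Lemma lasso_minimizer_stationary m n (A : 'M[R]_(m, n)) b lambda y j :
  l2norm (col j A) = 1 -> 0 <= lambda -> is_lasso_minimizer A b lambda y ->
  `|dotv (col j A) (A *m y - b)| <= lambda.
Proof.
move=> Aj l0 ymin; set g := dotv _ _; rewrite leNgt; apply/negP => lg.
pose t := `|g| - lambda; pose e := - (Num.sg g * t).
have t0 : 0 < t by rewrite subr_gt0.
have e1 : `|e| = t.
  rewrite normrN normrM normr_sg gtr0_norm// -normr_gt0.
  by rewrite (le_lt_trans l0 lg) mul1r.
have e2 : e ^+ 2 = t ^+ 2 by rewrite -(real_normK (num_real e)) e1.
have eg : e * g = - (t * `|g|) by rewrite normrEsg /e; ring.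
have := ymin (y + e *: delta_mx j 0); rewrite /lasso_objective.
rewrite mulmxDr -scalemxAr -colE addrAC l2norm_sqrDZ Aj expr1n mulr1 e2.
rewrite -/g -(mulrA 2) eg.
have := ler_wpM2l l0 (ler_l1normD y (e *: delta_mx j 0)).
rewrite l1norm_delta e1 mulrDr.
have : 0 < t ^+ 2 by rewrite exprn_gt0.
have : t * `|g| = t * lambda + t ^+ 2 by rewrite /t; ring.
rewrite (mulrC t lambda) => ->.
move: (lambda * l1norm _) (lambda * l1norm _) (l2norm _ ^+ 2) => *; lra.
Qed.

(** With [h = y - x], the residuals at [y] and [x] are [A h - z] and [- z]. Expanding the squares
    leaves [|A h|^2], which is dropped, and the cross term [<z, A h>], the sum of the
    [h_j <A_j, z>]. *)
Lemma lasso_minimizer_l1norm m n (A : 'M[R]_(m, n)) x z lambda tau y :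
  (forall j, `|dotv (col j A) z| <= tau) ->
  is_lasso_minimizer A (A *m x + z) lambda y ->
  lambda * l1norm y <= lambda * l1norm x + tau * l1norm (y - x).
Proof.
move=> ztau /(_ x); rewrite /lasso_objective opprD addNKr.
have -> : A *m y + (- (A *m x) - z) = - (z + (-1) *: (A *m (y - x))).
  by rewrite mulmxBr scaleN1r opprB addrA.
have nN (u : 'cV[R]_m) : l2norm (- u) ^+ 2 = l2norm u ^+ 2.
  by rewrite !l2norm_sqr; apply: eq_bigr => i _; rewrite mxE mulrNN.
rewrite !nN l2norm_sqrDZ dotvC dotv_mulmx.
have : \sum_j (y - x) j 0 * dotv (col j A) z <= tau * l1norm (y - x).
  rewrite /l1norm mulr_sumr; apply: ler_sum => j _.
  by rewrite (le_trans (ler_norm _))// normrM mulrC ler_wpM2r.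
have := dotv_ge0 (A *m (y - x)); rewrite -l2norm_sqr.
move: (\sum_j _) (tau * _) (lambda * _) (lambda * _) (l2norm _ ^+ 2) (l2norm _ ^+ 2).
by move=> *; lra.
Qed.

(** The Gram matrix [A^T A] has diagonal entry 1 at [j] and off-diagonal entries bounded by the
    coherence, so coordinate [j] of [A^T A h] is [h_j] up to an error of at most
    [coherence A * l1norm h]. *)
Lemma normr_le_gram m n (A : 'M[R]_(m, n)) (h : 'cV[R]_n) j :
  l2norm (col j A) = 1 ->
  `|h j 0| <= `|dotv (col j A) (A *m h)| + coherence A * l1norm h.
Proof.
move=> Aj; rewrite dotv_mulmx (bigD1 j)//= -l2norm_sqr Aj expr1n mulr1.
set r := \sum_(_ | _) _; rewrite -[X in `|X| <= _](addrK r).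
rewrite (le_trans (ler_normB _ _))// lerD2l.
rewrite (le_trans (ler_norm_sum _ _ _))// /l1norm mulr_sumr [leRHS](bigD1 j)//=.
rewrite ler_wpDl ?mulr_ge0 ?coherence_ge0//; apply: ler_sum => i ij.
by rewrite normrM mulrC ler_wpM2r// dotv_col_le_coherence.
Qed.

Lemma lasso_l1_error m n s (A : 'M[R]_(m, n)) sigma kappa x z y :
  normalized_columns A -> 0 < sigma -> 1 <= kappa -> sparse s x ->
  (forall j, `|dotv (col j A) z| <= kappa * sigma) ->
  is_lasso_minimizer A (A *m x + z) (2 * sigma * kappa) y ->
  (1 - 4 * s%:R * coherence A) * l1norm (y - x) <=
    12 * kappa * \sum_j Num.min sigma `|x j 0|.
Proof.
move=> nA s0 k1 sx ztau ymin; set h := y - x; set mu := coherence A.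
set H := l1norm h; set lambda := 2 * sigma * kappa in ymin *.
have l0 : 0 <= lambda by rewrite /lambda !mulr_ge0//; lra.
pose T j := sigma < `|x j 0|.
pose Q := \sum_(j | ~~ T j) `|x j 0|; pose N := \sum_(j | T j) `|h j 0|.
(* Coordinatewise, [|y_j| - |x_j|] is at least [- |h_j|] on [T] and at least [|h_j| - 2 |x_j|] off
   [T]. Since [lambda] is twice the noise level, the comparison of objectives gives
   [l1norm y - l1norm x <= H / 2]. *)
have cone : H <= 4 * N + 4 * Q.
  have : H - 2 * N - 2 * Q <= l1norm y - l1norm x.
    rewrite /H /N /Q /l1norm (big_mkcond T) (big_mkcond (predC T)).
    rewrite !mulr_sumr -!sumrB; apply: ler_sum => j _.
    have -> : h j 0 = y j 0 - x j 0 by rewrite !mxE.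
    rewrite /=; case: (T j) => /=.
      have := ler_normD (y j 0) (x j 0 - y j 0); rewrite addrCA subrr addr0.
      by rewrite distrC; lra.
    have := ler_normB (y j 0) (x j 0); lra.
  have := lasso_minimizer_l1norm ztau ymin.
  rewrite -/h -/H => Hy /(ler_wpM2l l0) Hx.
  have lk : lambda = 2 * (kappa * sigma) by rewrite /lambda; ring.
  have ks : 0 < kappa * sigma by rewrite mulr_gt0//; lra.
  rewrite -(ler_pM2l ks); rewrite lk in Hx Hy; nra.
(* The 3 is 2 from stationarity, [lambda] being [2 * kappa * sigma], plus 1 from the noise. *)
have hj j : `|h j 0| <= 3 * kappa * sigma + mu * H.
  rewrite (le_trans (normr_le_gram _ (nA j)))// lerD2r.
  have -> : A *m h = (A *m y - (A *m x + z)) + z.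
    by rewrite mulmxBr opprD addrA subrK.
  rewrite dotvDr (le_trans (ler_normD _ _))//.
  have := lasso_minimizer_stationary (nA j) l0 ymin.
  have := ztau j; rewrite /lambda; lra.
have H0 : 0 <= H by exact: l1norm_ge0.
have mu0 : 0 <= mu := coherence_ge0 A.
have cT : (#|T| <= s)%N.
  apply: leq_trans sx; apply: subset_leq_card; apply/fintype.subsetP => j.
  rewrite !inE /in_mem/= /T => sj; apply/eqP => xj0.
  by move: sj; rewrite xj0 normr0 ltNge (ltW s0).
(* [#|T|] is replaced by [s] in the coherence term only: the other one must keep [#|T| * sigma],
   which is the contribution of [T] to the sum of minima. *)
have NT : N <= #|T|%:R * (3 * kappa * sigma) + s%:R * (mu * H).
  apply: (@le_trans _ _ (#|T|%:R * (3 * kappa * sigma + mu * H))).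
    rewrite mulr_natl -sumr_const; exact: ler_sum.
  by rewrite mulrDr lerD2l ler_wpM2r ?mulr_ge0// ler_nat.
have MT : \sum_j Num.min sigma `|x j 0| = #|T|%:R * sigma + Q.
  rewrite (bigID T)/= mulr_natl -sumr_const; congr (_ + _); apply: eq_bigr => j.
    by rewrite /T => /ltW /min_l.
  by rewrite /T -leNgt => /min_r.
have Q0 : 0 <= Q by exact: sumr_ge0.
have kQ : Q <= kappa * Q by rewrite ler_peMl.
(* Inserting [NT] into [cone] gives [H <= 12 kappa #|T| sigma + 4 s mu H + 4 Q]; the term in [H]
   moves to the left and [4 Q] is at most [12 kappa Q]. *)
rewrite MT; nra.
Qed.

Lemma sum_min_sqr n (sigma : R) (x : 'cV[R]_n) : 0 < sigma ->
  \sum_j Num.min (sigma ^+ 2) (`|x j 0| ^+ 2) =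
  \sum_j Num.min sigma `|x j 0| ^+ 2.
Proof.
move=> s0; apply: eq_bigr => j _; case: (leP sigma `|x j 0|) => sx.
  by rewrite min_l// lerXn2r// ?nnegrE ltW.
by rewrite min_r// lerXn2r// ?nnegrE ltW.
Qed.

(** At most [s] terms are nonzero, and each is at most the root of the sum of all squares.
    Cauchy-Schwarz would give the root of [s]; the cruder factor suffices here. *)
Lemma sparse_sum_min n s (sigma : R) (x : 'cV[R]_n) : 0 < sigma -> sparse s x ->
  \sum_j Num.min sigma `|x j 0| <=
  s%:R * Num.sqrt (\sum_j Num.min (sigma ^+ 2) (`|x j 0| ^+ 2)).
Proof.
move=> s0 sx; rewrite (sum_min_sqr x s0); set D := Num.sqrt _.
have m0 j : 0 <= Num.min sigma `|x j 0| by rewrite le_min (ltW s0)/=.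
have mD j : Num.min sigma `|x j 0| <= D.
  rewrite -(ger0_norm (m0 j)) -sqrtr_sqr ler_wsqrtr// [leRHS](bigD1 j)//=.
  by rewrite lerDl; apply: sumr_ge0 => i _; rewrite sqr_ge0.
rewrite (bigID (fun j => x j 0 != 0))/= [X in _ + X]big1 ?addr0 => [|j].
  apply: (@le_trans _ _ (#|[pred i | x i 0 != 0]|%:R * D)).
    rewrite mulr_natl -sumr_const; exact: ler_sum.
  by rewrite ler_wpM2r ?sqrtr_ge0// ler_nat.
by rewrite negbK => /eqP ->; rewrite normr0 min_r// ltW.
Qed.

Lemma lasso_l2_error m n s (A : 'M[R]_(m, n)) sigma L x z y :
  (m < n)%N -> (0 < s)%N -> normalized_columns A -> 0 < sigma -> 0 <= L ->
  sparse s x -> coherence A < 1 / (4 * s%:R) ->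
  (forall j, `|dotv (col j A) z| <= (5 / 4 + L) * sigma) ->
  is_lasso_minimizer A (A *m x + z) (2 * sigma * (5 / 4 + L)) y ->
  l2norm (y - x) ^+ 2 <=
  16 * (2 + L) ^+ 2 / (coherence A * (1 - 4 * s%:R * coherence A)) ^+ 2 *
    \sum_(j < n) Num.min (sigma ^+ 2) (`|x j 0| ^+ 2).
Proof.
move=> mn s1 nA s0 L0 sx; set mu := coherence A => muA ztau ymin.
have mu0 : 0 < mu by exact: coherence_gt0.
have s1' : 0 < s%:R :> R by rewrite ltr0n.
have smu : 4 * s%:R * mu < 1.
  by move: muA; rewrite ltr_pdivlMr ?mulr_gt0// mulrC.
have k1 : 1 <= 5 / 4 + L by lra.
have := lasso_l1_error nA s0 k1 sx ztau ymin.
have := sparse_sum_min s0 sx.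
rewrite -/mu; set M := \sum_j _; set S := \sum_j _; set H := l1norm _ => MS HM.
have S0 : 0 <= S.
  by apply: sumr_ge0 => j _; rewrite le_min !sqr_ge0.
rewrite (le_trans (l2norm_sqr_le_l1norm _))// -/H.
have c0 : 0 < mu * (1 - 4 * s%:R * mu) by rewrite mulr_gt0// subr_gt0.
(* Once the denominator is cleared, both sides are squares of nonnegative numbers, so their roots
   are compared. *)
rewrite mulrAC ler_pdivlMr ?exprn_gt0// -(sqr_sqrtr S0).
have -> : 16 * (2 + L) ^+ 2 * Num.sqrt S ^+ 2 = (4 * (2 + L) * Num.sqrt S) ^+ 2.
  by ring.
have H0 : 0 <= H by exact: l1norm_ge0.
have D0 := sqrtr_ge0 S.
have k0 : 0 <= 4 * (2 + L) * Num.sqrt S by rewrite mulr_ge0//; lra.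
have Hc0 : 0 <= H * (mu * (1 - 4 * s%:R * mu)) by rewrite mulr_ge0// ltW.
rewrite -exprMn lerXn2r//.
apply: (@le_trans _ _ (mu * (12 * (5 / 4 + L) * (s%:R * Num.sqrt S)))).
  rewrite mulrCA ler_wpM2l ?(ltW mu0)// mulrC (le_trans HM)// ler_wpM2l//; lra.
(* Here [4 s mu < 1] absorbs [s], and [3 (5/4 + L) <= 4 (2 + L)] yields the stated constant 16 after
   squaring. *)
have -> : mu * (12 * (5 / 4 + L) * (s%:R * Num.sqrt S)) =
  (4 * s%:R * mu) * (3 * (5 / 4 + L) * Num.sqrt S) by ring.
apply: (@le_trans _ _ (3 * (5 / 4 + L) * Num.sqrt S)).
  rewrite ler_piMl ?(ltW smu)// mulr_ge0//; lra.
by rewrite ler_wpM2r//; lra.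
Qed.

End Vectors.

(** * Change of variables with a density, finite unions, and expectations of products *)

Section Measure.
Set Implicit Arguments.
Unset Strict Implicit.
Import HBNNSimple.

(** The hypothesis on sets [B] says that the image under [phi] of the measure with density [g] is
    [c * nu]. It passes to simple functions by linearity, then to nonnegative functions by monotone
    convergence. *)
Lemma ge0_integral_comp_density d1 d2 (T1 : measurableType d1)
    (T2 : measurableType d2) (R : realType) (mu : {measure set T1 -> \bar R})
    (nu : {measure set T2 -> \bar R}) (phi : T1 -> T2) (g : T1 -> R) (c : R) :
  measurable_fun [set: T1] phi -> measurable_fun [set: T1] g ->
  (forall x, 0 <= g x) -> 0 <= c ->
  (forall B, measurable B ->
     \int[mu]_x (g x * \1_B (phi x))%:E = c%:E * nu B)%E ->
  forall f : T2 -> R, measurable_fun [set: T2] f -> (forall y, 0 <= f y) ->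
  (\int[mu]_x (g x * f (phi x))%:E = c%:E * \int[nu]_y (f y)%:E)%E.
Proof.
move=> mphi mg g0 c0 gB f mf f0.
have simple (h : {nnsfun T2 >-> R}) :
    (\int[mu]_x (g x * h (phi x))%:E = c%:E * \int[nu]_y (h y)%:E)%E.
  transitivity (\int[mu]_x (\sum_(k \in range h)
      k%:E * (g x * \1_(h @^-1` [set k]) (phi x))%:E))%E.
    apply: eq_integral => x _; rewrite fimfunE EFinM -fsumEFin//.
    rewrite ge0_mule_fsumr; last by move=> k; exact: nnfun_muleindic_ge0.
    by apply: eq_fsbigr => k _; rewrite -!EFinM mulrCA.
  have mB k : measurable_fun [set: T1]
      (fun x => g x * \1_(h @^-1` [set k]) (phi x)).
    apply: measurable_funM => //.
    exact: (measurableT_comp (measurable_indic _)).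
  rewrite ge0_integral_fsum//; first last.
  - move=> k x _; rewrite EFinM muleCA mule_ge0 ?lee_fin//.
    by rewrite -lee_fin; exact: nnfun_muleindic_ge0.
  - move=> k; apply: emeasurable_funM; first exact: measurable_cst.
    exact/measurable_EFinP.
  rewrite integralT_nnsfun sintegralE ge0_mule_fsumr; last first.
    by move=> k; exact: nnsfun_mulemu_ge0.
  apply: eq_fsbigr => k; rewrite inE => -[y _ <-].
  rewrite ge0_integralZl//; first last.
  - by rewrite lee_fin.
  - by move=> x _; rewrite lee_fin mulr_ge0.
  - exact/measurable_EFinP.
  by rewrite gB// muleCA.
have mf' : measurable_fun [set: T2] (EFin \o f) by exact/measurable_EFinP.
pose f_ := nnsfun_approx measurableT mf'.
have f_cvg y : (f_ n y)%:E @[n --> \oo] --> (f y)%:E.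
  by apply: (cvg_nnsfun_approx measurableT mf') => // z _; rewrite lee_fin.
transitivity (limn (fun n => \int[mu]_x (g x * f_ n (phi x))%:E)%E).
  rewrite -monotone_convergence//; first last.
  - move=> x _ a b ab; rewrite lee_fin ler_wpM2l//.
    exact/lefP/nd_nnsfun_approx.
  - by move=> n x _; rewrite lee_fin mulr_ge0.
  - move=> n; apply/measurable_EFinP/measurable_funM => //.
    exact: measurableT_comp.
  apply: eq_integral => x _; apply/esym/cvg_lim => //.
  under eq_fun do rewrite EFinM.
  by rewrite EFinM; apply: cvgeZl => //; exact: f_cvg.
under eq_fun do rewrite simple.
rewrite limeMl//; last first.
  apply: ereal_nondecreasing_is_cvgn => a b ab; apply: ge0_le_integral => //.
  - by move=> y _; rewrite lee_fin.
  - exact/measurable_EFinP.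
  - exact/measurable_EFinP.
  - by move=> y _; rewrite lee_fin; exact/lefP/nd_nnsfun_approx.
congr (_ * _)%E; rewrite -monotone_convergence//; first last.
- by move=> y _ a b ab; rewrite lee_fin; exact/lefP/nd_nnsfun_approx.
- by move=> n y _; rewrite lee_fin.
- by move=> n; exact/measurable_EFinP.
by apply: eq_integral => y _; apply/cvg_lim => //; exact: f_cvg.
Qed.

Lemma measurable_forall_fin d (T : measurableType d) (I : finType)
    (A : I -> set T) :
  (forall i, measurable (A i)) -> measurable [set w | forall i, A i w].
Proof.
move=> mA; rewrite (_ : [set _ | _] = \bigcap_(i in [set: I]) A i).
  exact: fin_bigcap_measurable.
by apply/seteqP; split => w /= Aw i; [move=> _; exact: Aw|exact: Aw].
Qed.

Lemma measurable_exists_fin d (T : measurableType d) (I : finType)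
    (A : I -> set T) :
  (forall i, measurable (A i)) -> measurable [set w | exists i, A i w].
Proof.
move=> mA; rewrite (_ : [set _ | _] = \bigcup_(i in [set: I]) A i).
  exact: fin_bigcup_measurable.
by apply/seteqP; split => w /=; [case=> i|case=> i _]; exists i.
Qed.

Lemma measure_exists_fin_le d (T : measurableType d) (R : realType)
    (P : {measure set T -> \bar R}) (I : finType) (A : I -> set T) :
  (forall i, measurable (A i)) ->
  (P [set w | exists i, A i w] <= \sum_i P (A i))%E.
Proof.
move=> mA; have [_] : measurable (\big[setU/set0]_i A i) /\
    (P (\big[setU/set0]_i A i) <= \sum_i P (A i))%E.
  elim/big_ind2 : _ => [|B b C c [mB Bb] [mC Cc]|i _].
  - by rewrite measure0.
  - split; first exact: measurableU.
    by rewrite (le_trans (measureU2 _ mB mC))// leeD.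
  - by split.
apply: le_trans; rewrite le_measure ?inE//.
- exact: measurable_exists_fin.
- exact: bigsetU_measurable.
- by move=> w [i Ai]; rewrite -bigcup_seq; exists i => //=; rewrite mem_index_enum.
Qed.

(* The indicators of the box are replaced by arbitrary functions one coordinate
   at a time. *)
Lemma ge0_expectation_prod d d2 (T : measurableType d)
    (T2 : measurableType d2) (R : realType) (P : probability T R)
    (nu : probability T2 R) m (X : 'I_m -> T -> T2) :
  (forall i, measurable_fun [set: T] (X i)) ->
  (forall B : 'I_m -> set T2, (forall i, measurable (B i)) ->
     P [set w | forall i, B i (X i w)] = (\prod_(i < m) nu (B i))%E) ->
  forall (f : 'I_m -> T2 -> R) (c : 'I_m -> R),
  (forall i, measurable_fun [set: T2] (f i)) -> (forall i y, 0 <= f i y) ->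
  (forall i, \int[nu]_y (f i y)%:E = (c i)%:E)%E ->
  (\int[P]_w (\prod_i f i (X i w))%:E = (\prod_i c i)%:E)%E.
Proof.
move=> mX PX f c mf f0 fc.
(* Induction on [k]: coordinates below [k] carry arbitrary functions, the others still carry
   indicators. At [k = 0] the product is the indicator of a box. *)
suff main k : (k <= m)%N -> forall (f : 'I_m -> T2 -> R) (c : 'I_m -> R),
    (forall i, measurable_fun [set: T2] (f i)) -> (forall i y, 0 <= f i y) ->
    (forall i, \int[nu]_y (f i y)%:E = (c i)%:E)%E ->
    (forall i : 'I_m, (k <= i)%N -> exists2 B, measurable B & f i = \1_B) ->
    (\int[P]_w (\prod_i f i (X i w))%:E = (\prod_i c i)%:E)%E.
  by apply: (main m) => // i; rewrite leqNgt ltn_ord.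
elim: k => [_|k ih km] {mf f0 fc}f {}c mf f0 fc fB.
  have /choice [B /all_and2[mB fE]] (i : 'I_m) :
      exists B, measurable B /\ f i = \1_B.
    by have [B ? ?] := fB i isT; exists B.
  transitivity (\int[P]_w (\1_[set w | forall i, B i (X i w)] w)%:E)%E.
    apply: eq_integral => w _; congr _%:E; rewrite indicE.
    under eq_bigr do rewrite fE indicE.
    have [Bw|/existsNP[i Bi]] := pselect (forall i, B i (X i w)).
      by rewrite mem_set// big1// => i _; rewrite mem_set.
    rewrite memNset => [|/(_ i)//].
    by rewrite (bigD1 i)//= memNset// mul0r.
  rewrite integral_indic//; last first.
    apply: measurable_forall_fin => i.
    by rewrite -[X in measurable X]setTI; exact: mX.
  rewrite setIT; apply: etrans (PX B mB) _; rewrite -prodEFin; apply: eq_bigr => i _.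
  by rewrite -fc fE integral_indic// setIT.
pose i0 := Ordinal km.
pose upd (U : Type) (F : 'I_m -> U) (u : U) (i : 'I_m) := if i == i0 then u else F i.
have updP U (F : 'I_m -> U) u : upd _ F u i0 = u by rewrite /upd eqxx.
have prod_upd (F : 'I_m -> R) u :
    \prod_i upd _ F u i = (\prod_(i | i != i0) F i) * u.
  rewrite (bigD1 i0)//= updP mulrC; congr (_ * _).
  by apply: eq_bigr => i /negbTE ne; rewrite /upd ne.
have c0 i : 0 <= c i.
  by rewrite -lee_fin -fc; apply: integral_ge0 => y _; rewrite lee_fin.
transitivity (\int[P]_w ((\prod_(i | i != i0) f i (X i w)) * f i0 (X i0 w))%:E)%E.
  by apply: eq_integral => w _; rewrite (bigD1 i0)//= mulrC.
rewrite [in RHS](bigD1 i0)//= mulrC EFinM -fc.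
(* The product of the other factors is the density [g], and [X i0] is the map [phi]. The required
   identity on sets [B] is the induction hypothesis with [\1_B] in place of [f i0]. *)
apply: ge0_integral_comp_density => //.
- rewrite (_ : (fun _ => _) = (fun w => \prod_i upd _ (fun i => f i (X i w)) 1 i)).
    apply: measurable_prod => i _; rewrite /upd; case: eqP => // _.
    exact: measurableT_comp.
  by apply/funext => w; rewrite prod_upd mulr1.
- by move=> w; apply: prodr_ge0.
- exact: prodr_ge0.
move=> B mB.
have nuB : nu B \is a fin_num by exact: fin_num_measure.
have := ih (ltnW km) (upd _ f \1_B) (upd _ c (fine (nu B))).
rewrite prod_upd EFinM fineK// => <-.
- apply: eq_integral => w _; congr _%:E; rewrite -prod_upd; apply: eq_bigr => i _.
  by rewrite /upd; case: eqP => [->|].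
- by move=> i; rewrite /upd; case: eqP.
- by move=> i y; rewrite /upd; case: eqP => // _; rewrite indicE.
- move=> i; rewrite /upd; case: eqP => // _.
  by rewrite integral_indic// setIT fineK.
- move=> i ki; rewrite /upd; case: eqP => [_|ii0]; first by exists B.
  apply: fB; rewrite ltn_neqAle ki andbT; apply/eqP => kE.
  by apply: ii0; apply: val_inj.
Qed.

End Measure.

(** * Moment generating functions and tails of Gaussian vectors *)

Section Gaussian.
Context {R : realType}.
Set Implicit Arguments.
Unset Strict Implicit.
Implicit Types sigma t : R.

(** Completing the square: exponential tilting shifts the mean to [t * sigma ^+ 2]. The moment
    generating function follows, as the shifted density still integrates to 1. *)
Lemma normal_pdf_tilt sigma t x : sigma != 0 ->
  normal_pdf 0 sigma x * expR (t * x) =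
  expR (t ^+ 2 * sigma ^+ 2 / 2) * normal_pdf (t * sigma ^+ 2) sigma x.
Proof.
move=> s0; rewrite !normal_pdfE// mulrCA -(mulrA (normal_peak _)) /normal_fun -!expRD.
by rewrite -(mulr_natr (sigma ^+ 2)); congr (_ * expR _); field.
Qed.

Lemma normal_prob_mgf sigma t : sigma != 0 ->
  (\int[normal_prob 0%R sigma]_y (expR (t * y))%:E =
   (expR (t ^+ 2 * sigma ^+ 2 / 2))%:E)%E.
Proof.
move=> s0.
have := @ge0_integral_comp_density _ _ (measurableTypeR R) (measurableTypeR R) R
  (@lebesgue_measure R) (normal_prob 0 sigma) id (normal_pdf 0 sigma) 1.
move=> /(_ (@measurable_id _ _ _) (measurable_normal_pdf 0 sigma)
           (normal_pdf_ge0 0 sigma) ler01 _ (fun y => expR (t * y))).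
rewrite mul1e => <-; first last.
- by move=> y; exact: expR_ge0.
- by apply: measurableT_comp => //; exact: measurable_funM.
- move=> B mB; rewrite mul1e /normal_prob [RHS]integral_mkcond.
  by rewrite epatch_indic.
under eq_integral do rewrite normal_pdf_tilt// EFinM.
rewrite ge0_integralZl_EFin ?expR_ge0//.
- by rewrite integral_normal_pdf mule1.
- by move=> x _; rewrite lee_fin normal_pdf_ge0.
- by apply: measurableT_comp => //; exact: measurable_normal_pdf.
Qed.

Context d (T : measurableType d) (P : probability T R).

Lemma isotropic_gaussian_measurable m sigma (z : T -> 'cV[R]_m) (a : 'cV[R]_m) :
  isotropic_gaussian P sigma z ->
  measurable_fun [set: T] (fun w => dotv a (z w)).
Proof.
move=> [mz _]; apply: measurable_sum => i.
by apply: measurable_funM => //; exact: measurable_cst.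
Qed.

(** The exponential of the inner product factors over the independent coordinates, and the exponents
    add up to the squared norm of [a]. Chernoff's bound needs only this. *)
Lemma isotropic_gaussian_mgf m sigma (z : T -> 'cV[R]_m) (a : 'cV[R]_m) t :
  sigma != 0 -> isotropic_gaussian P sigma z ->
  (\int[P]_w (expR (t * dotv a (z w)))%:E =
   (expR (t ^+ 2 * sigma ^+ 2 / 2 * l2norm a ^+ 2))%:E)%E.
Proof.
move=> s0 [mz Pz].
transitivity (\int[P]_w (\prod_i expR (t * a i 0 * z w i 0))%:E)%E.
  apply: eq_integral => w _; rewrite -expR_sum; congr (expR _)%:E.
  by rewrite /dotv mulr_sumr; apply: eq_bigr => i _; rewrite mulrA.
have -> := @ge0_expectation_prod _ _ T (measurableTypeR R) R P
  (normal_prob 0 sigma) m (fun i w => z w i 0) mz Pz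
  (fun i y => expR (t * a i 0 * y))
  (fun i => expR ((t * a i 0) ^+ 2 * sigma ^+ 2 / 2)).
- rewrite -expR_sum l2norm_sqr; congr (expR _)%:E.
  by rewrite /dotv mulr_sumr; apply: eq_bigr => i _; ring.
- by move=> i; apply: measurableT_comp => //; exact: measurable_funM.
- by move=> i y; exact: expR_ge0.
- by move=> i; exact: normal_prob_mgf.
Qed.

Lemma isotropic_gaussian_tail m sigma (z : T -> 'cV[R]_m) (a : 'cV[R]_m) t :
  0 < sigma -> 0 < t -> l2norm a = 1 -> isotropic_gaussian P sigma z ->
  (P [set w | t * sigma <= dotv a (z w)]%R <= (expR (- (t ^+ 2 / 2)))%:E)%E.
Proof.
move=> s0 t0 a1 Pz; have mX := isotropic_gaussian_measurable a Pz.
pose X : {RV P >-> R} := HB.pack (fun w => dotv a (z w))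
  (isMeasurableFun.Build _ _ _ _ _ mX).
(* The parameter [r = t / sigma] minimizes the Chernoff exponent
   [r ^+ 2 * sigma ^+ 2 / 2 - r * t * sigma]. *)
have := chernoff X (t * sigma) (divr_gt0 t0 s0).
have -> : ('M_P X (t / sigma) = (expR (t ^+ 2 / 2))%:E)%E.
  rewrite /mmt_gen_fun unlock /=; under eq_integral do rewrite mulrC.
  rewrite (isotropic_gaussian_mgf _ _ _ Pz) ?gt_eqF// a1 expr1n mulr1.
  by congr (expR _)%:E; field; rewrite gt_eqF.
move=> /le_trans; apply; rewrite -EFinM -expRD lee_fin ler_expR.
have -> : t / sigma * (t * sigma) = t ^+ 2 by field; rewrite gt_eqF.
lra.
Qed.

Lemma isotropic_gaussian_two_sided_tail m sigma (z : T -> 'cV[R]_m)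
    (a : 'cV[R]_m) t :
  0 < sigma -> 0 < t -> l2norm a = 1 -> isotropic_gaussian P sigma z ->
  (P [set w | t * sigma <= `|dotv a (z w)|]%R <=
   (2 * expR (- (t ^+ 2 / 2)))%:E)%E.
Proof.
move=> s0 t0 a1 Pz.
have mS b : measurable [set w | t * sigma <= dotv b (z w)].
  rewrite -[X in measurable X]setTI.
  have := isotropic_gaussian_measurable b Pz measurableT
    (measurable_itv `[t * sigma, +oo[).
  by congr measurable; apply/seteqP; split => w /=; rewrite in_itv/= andbT.
have Na1 : l2norm (- a) = 1.
  by rewrite -a1; congr Num.sqrt; apply: eq_bigr => i _; rewrite mxE sqrrN.
have dN w : dotv (- a) (z w) = - dotv a (z w).
  by rewrite /dotv -sumrN; apply: eq_bigr => i _; rewrite mxE mulNr.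
rewrite [X in P X](_ : _ = [set w | t * sigma <= dotv a (z w)] `|`
    [set w | t * sigma <= dotv (- a) (z w)]); last first.
  apply/seteqP; split => w /=; rewrite dN ler_normr => /orP //.
rewrite (le_trans (measureU2 _ (mS _) (mS _)))// mulr_natl mulr2n EFinD.
by apply: leeD; exact: isotropic_gaussian_tail.
Qed.

End Gaussian.

(** * Numerical estimate of the failure probability *)

Section FailureProbability.
Set Implicit Arguments.
Unset Strict Implicit.

(** Used for [6 L = 24/5 * (5/4 L)] in the next proof. Bernoulli-type bounds on eight equal factors
    give about 4.99, just above [24/5]. *)
Lemma expR_57_32 (R : realType) : 24 / 5 <= expR (57 / 32 : R).
Proof.
have -> : 57 / 32 = 57 / 256 * 8%:R :> R by lra.
rewrite expRM_natr (@le_trans _ _ ((1 + 57 / 256) ^+ 8))//; first lra.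
by rewrite lerXn2r ?nnegrE ?expR_ge0 ?expR_ge1Dx//; lra.
Qed.

(* Since n = exp (L^2 / 2), the left-hand side is
   2 exp (- 25/32 - 5/4 L), and L <= 4/5 exp (5/4 L - 1). *)
Lemma lasso_failure_probability (R : realType) n (L : R) :
  (1 < n)%N -> L = Num.sqrt (2 * ln n%:R) ->
  n%:R * (2 * expR (- ((5 / 4 + L) ^+ 2 / 2))) <=
  1 / (2 * Num.sqrt (pi * ln n%:R)).
Proof.
move=> n1 LE; have ln0 : 0 < ln n%:R :> R by rewrite ln_gt0// ltr1n.
have L2 : L ^+ 2 = 2 * ln n%:R by rewrite LE sqr_sqrtr// mulr_ge0// ltW.
have L0 : 0 <= L by rewrite LE sqrtr_ge0.
set q := Num.sqrt (pi * _).
have q0 : 0 < q by rewrite sqrtr_gt0 mulr_gt0// pi_gt0.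
(* [q ^+ 2 = (pi / 2) * L ^+ 2], and [pi / 2 < 2 < 9/4]. *)
have qL : q <= 3 / 2 * L.
  rewrite -(ger0_norm (ltW q0)) -(@ger0_norm _ (3 / 2 * L)); last by lra.
  rewrite -ler_sqr ?nnegrE// !real_normK ?num_real//.
  rewrite sqr_sqrtr ?mulr_ge0 ?pi_ge0 ?ltW// exprMn L2.
  have := pihalf_lt2 R; nra.
have nE : n%:R = expR (L ^+ 2 / 2) :> R.
  by rewrite L2 mulrAC divff// mul1r lnK// posrE ltr0n (ltn_trans _ n1).
rewrite ler_pdivlMr ?mulr_gt0// nE.
(* The total exponent [- 25/32 - 5/4 L] is split as [- 57/32 - (5/4 L - 1)], so that
   [1 + u <= exp u] at [u = 5/4 L - 1] gives exactly [5/4 L]. *)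
have -> : expR (L ^+ 2 / 2) * (2 * expR (- ((5 / 4 + L) ^+ 2 / 2))) * (2 * q) =
    4 * q / (expR (57 / 32) * expR (5 / 4 * L - 1)).
  rewrite -expRD -expRN.
  transitivity (4 * q * (expR (L ^+ 2 / 2) * expR (- ((5 / 4 + L) ^+ 2 / 2)))).
    by ring.
  by rewrite -expRD; congr (_ * expR _); field.
rewrite ler_pdivrMr ?mulr_gt0 ?expR_gt0// mul1r.
have := expR_57_32 R; have := expR_ge1Dx (5 / 4 * L - 1); nra.
Qed.

End FailureProbability.

Theorem theorem3p2 (R : realType) (d : measure_display) (T : measurableType d)
  (P : probability T R) (m n s : nat) (A : 'M[R]_(m, n)) (sigma : R)
  (x : 'cV[R]_n) (z : T -> 'cV[R]_m) (xhat : T -> 'cV[R]_n) :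
  let mu := coherence A in
  let L := Num.sqrt (2 * ln n%:R) in
  let lambda := 2 * sigma * (5 / 4 + L) in
  (m < n)%N ->
  (1 <= s <= n)%N ->
  normalized_columns A ->
  0 < sigma ->
  isotropic_gaussian P sigma z ->
  sparse s x ->
  mu < 1 / (4 * s%:R) ->
  (forall w, is_lasso_minimizer A (A *m x + z w) lambda (xhat w)) ->
  with_probability_ge P (1 - 1 / (2 * Num.sqrt (pi * ln n%:R)))
    [set w | l2norm (xhat w - x) ^+ 2 <=
             16 * (2 + L) ^+ 2 / (mu * (1 - 4 * s%:R * mu)) ^+ 2 *
             \sum_(j < n) Num.min (sigma ^+ 2) (`|x j 0| ^+ 2)].
Proof.
move=> mu L lambda mn /andP[s1 _] nA s0 Pz sx smu xmin.
have L0 : 0 <= L := sqrtr_ge0 _.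
have k0 : 0 < 5 / 4 + L by lra.
(* This makes [ln n] positive. If [m] were 0, the columns would be empty and could not have norm 1;
   so [1 <= m < n]. *)
have n1 : (1 < n)%N.
  case: m A z mn nA Pz @mu @lambda smu xmin => [|m] A z mn nA *.
    have := nA (Ordinal mn); rewrite /l2norm big_ord0 sqrtr0 => /esym/eqP.
    by rewrite oner_eq0.
  exact: leq_ltn_trans mn.
pose bad j := [set w | (5 / 4 + L) * sigma <= `|dotv (col j A) (z w)|].
have mabs j : measurable_fun [set: T] (fun w => `|dotv (col j A) (z w)|).
  apply: measurableT_comp => //; exact: isotropic_gaussian_measurable Pz.
have mle j : measurable (bad j).
  rewrite -[bad j]setTI.
  have := mabs j measurableT _ (measurable_itv `[(5 / 4 + L) * sigma, +oo[).
  by congr measurable; apply/seteqP; split => w /=; rewrite in_itv/= andbT.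
(* The event constrains the noise alone, so its measurability does not involve the selection
   [xhat]. *)
pose E := [set w | forall j, `|dotv (col j A) (z w)| <= (5 / 4 + L) * sigma].
have mE : measurable E.
  apply: (@measurable_forall_fin _ T _
    (fun j => [set w | `|dotv (col j A) (z w)| <= (5 / 4 + L) * sigma])) => j.
  rewrite -[X in measurable X]setTI.
  have := mabs j measurableT _ (measurable_itv `]-oo, (5 / 4 + L) * sigma]).
  by congr measurable; apply/seteqP; split => w /=; rewrite in_itv.
exists E; split => //.
  by move=> w Ew /=; exact: (lasso_l2_error mn s1 nA s0 L0 sx smu Ew (xmin w)).
rewrite -[E]setCK probability_setC; last exact: measurableC.
rewrite EFinB leeB//.
(* Outside [E] some correlation strictly exceeds the threshold; [bad j] also includes equality, to
   match the form of the tail bound. *)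
apply: (@le_trans _ _ (P [set w | exists j, bad j w])).
  apply: le_measure; rewrite ?inE; first exact: measurableC.
    exact: measurable_exists_fin.
  move=> w /existsNP[j /negP]; rewrite -ltNge => /ltW jw.
  by exists j.
apply: le_trans (measure_exists_fin_le P mle) _.
apply: (@le_trans _ _ (\sum_(j < n) (2 * expR (- ((5 / 4 + L) ^+ 2 / 2)))%:E)%E).
  apply: lee_sum => j _.
  exact: (isotropic_gaussian_two_sided_tail s0 k0 (nA j) Pz).
rewrite sumEFin lee_fin sumr_const card_ord -[leLHS]mulr_natl.
exact: (lasso_failure_probability n1 erefl).
Qed.
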